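(* Let $S\in\mathbb{R}^3$ be a fixed point and let $m>0$. Suppose an object $O$ is placed in motion at distance $r_0>0$ from $S$ with initial speed $v_0>0$ and with initial velocity making an angle $\alpha_0$, not equal to $0^\circ$ or $180^\circ$, with the radial line from $S$, and that $O$ is always (for all times in $\mathbb{R}$, past and future) subject to an acceleration of $m/r^2$ towards $S$, where $r$ is its distance from $S$. Put $$C=v_0^2-\frac{2m}{r_0},\qquad Q=r_0^2v_0^2\sin^2\alpha_0 .$$ Then $O$ travels along a parabola if $C=0$, an ellipse if $C<0$, and a hyperbola if $C>0$. Moreover: (i) if $C=0$, the minimal distance $O$ attains from $S$ is $\dfrac{r_0^2v_0^2\sin^2\alpha_0}{2m}$; (ii) if $C\neq 0$, then $m^2+CQ\ge 0$ and the minimal distance $O$ attains from $S$ is $$\frac{-m+\sqrt{m^2+\left(v_0^2-\frac{2m}{r_0}\right)r_0^2v_0^2\sin^2\alpha_0}}{v_0^2-\frac{2m}{r_0}};$$ (iii) if $C<0$, the maximal distance $O$ attains from $S$ is $$\frac{-m-\sqrt{m^2+\left(v_0^2-\frac{2m}{r_0}\right)r_0^2v_0^2\sin^2\alpha_0}}{v_0^2-\frac{2m}{r_0}}.$$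
   Context: The motion $x:\mathbb{R}\to\mathbb{R}^3\setminus\{S\}$ of $O$ satisfies $x''=-m(x-S)/|x-S|^3$, with $r=|x-S|$. Circles count as special cases of ellipses. In the parabola and hyperbola cases the minimum may be attained only at a time before the initial time (one may need to run time backwards), which is why all times in $\mathbb{R}$ are considered. *)

(* Defs.v *)
From Stdlib Require Import Reals Lra.
From Coquelicot Require Import Coquelicot.
Open Scope R_scope.

(** Euclidean space R^3.  Coquelicot's norm on a product is the square root of
    the sum of the squares of the norms of the components, so [norm] on [R3] is
    the Euclidean norm (see [norm_R3]). *)
Definition R3 : NormedModule R_AbsRing :=
  prod_NormedModule R_AbsRing
    (prod_NormedModule R_AbsRing R_NormedModule R_NormedModule) R_NormedModule.

Definition dot (u v : R3) : R :=
  fst (fst u) * fst (fst v) + snd (fst u) * snd (fst v) + snd u * snd v.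

Lemma norm_R3 (u : R3) : norm u = sqrt (dot u u).
Proof.
destruct u as [[a b] c].
change (sqrt ((sqrt (Rabs a ^ 2 + Rabs b ^ 2)) ^ 2 + Rabs c ^ 2)
        = sqrt (a * a + b * b + c * c)).
rewrite pow2_sqrt.
- now rewrite !pow2_abs; f_equal; ring.
- rewrite !pow2_abs; nra.
Qed.

Definition dist3 (x y : R3) : R := norm (minus x y).

(** The unoriented angle, in radians, in [0, PI]; meaningful for nonzero [u], [v]. *)
Definition angle (u v : R3) : R := acos (dot u v / (norm u * norm v)).

Definition is_plane (P : R3 -> Prop) : Prop :=
  exists A n : R3, n <> zero /\ forall x, P x <-> dot n (minus x A) = 0.

Definition is_line (L : R3 -> Prop) : Prop :=
  exists A d : R3, d <> zero /\
    forall x, L x <-> exists s : R, x = plus A (scal s d).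

Definition dist_to_set (x : R3) (L : R3 -> Prop) : Rbar :=
  Glb_Rbar (fun d => exists y, L y /\ d = dist3 x y).

(** Nondegenerate conics of a plane of R^3, as loci. *)

Definition is_parabola (E : R3 -> Prop) : Prop :=
  exists (P L : R3 -> Prop) (F : R3),
    is_plane P /\ is_line L /\ (forall y, L y -> P y) /\ P F /\ ~ L F /\
    forall x, E x <-> P x /\ Finite (dist3 x F) = dist_to_set x L.

(** [F1 = F2] is allowed: circles are ellipses. *)
Definition is_ellipse (E : R3 -> Prop) : Prop :=
  exists (P : R3 -> Prop) (F1 F2 : R3) (a : R),
    is_plane P /\ P F1 /\ P F2 /\ dist3 F1 F2 < 2 * a /\
    forall x, E x <-> P x /\ dist3 x F1 + dist3 x F2 = 2 * a.

(** Both branches. *)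
Definition is_hyperbola (E : R3 -> Prop) : Prop :=
  exists (P : R3 -> Prop) (F1 F2 : R3) (a : R),
    is_plane P /\ P F1 /\ P F2 /\ 0 < 2 * a < dist3 F1 F2 /\
    forall x, E x <-> P x /\ Rabs (dist3 x F1 - dist3 x F2) = 2 * a.

Definition travels_along (x : R -> R3) (kind : (R3 -> Prop) -> Prop) : Prop :=
  exists E : R3 -> Prop, kind E /\ forall t, E (x t).

(** The extremal distances are required to be attained at some time in R. *)

Definition is_minimal_distance (x : R -> R3) (S : R3) (d : R) : Prop :=
  (exists t, dist3 (x t) S = d) /\ forall t, d <= dist3 (x t) S.

Definition is_maximal_distance (x : R -> R3) (S : R3) (d : R) : Prop :=
  (exists t, dist3 (x t) S = d) /\ forall t, dist3 (x t) S <= d.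

(** [x] avoids [S], has velocity [v], and satisfies
    x'' = - m (x - S) / |x - S|^3 at all times. *)
Definition inverse_square_motion (S : R3) (m : R) (x v : R -> R3) : Prop :=
  forall t : R,
    x t <> S /\ is_derive x t (v t) /\
    is_derive v t (scal (- m / dist3 (x t) S ^ 3) (minus (x t) S)).

(* Main.v *)
(** The energy [C], the angular momentum [h = y x v] and the Laplace vector
    [e = v x h - m y / r], where [y = x - S], are constants of the motion. They satisfy
    [h . y = 0], [m r = Q - e . y] and [e . e = m^2 + C Q] with [Q = h . h], so the orbit
    lies on the conic of the plane orthogonal to [h] that has focus [S], directrix
    [e . y = Q] when [C = 0], and second focus [S + (2 / C) e] otherwise.
    Since [(r r')^2 = C r^2 + 2 m r - Q], the bounds on [r] are algebraic. They are attained
    because Barker's cubic in [r r'] (for [C >= 0]) or the eccentric anomaly (for [C < 0])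
    is a function of time with derivative bounded below, hence takes all real values. *)

Require Import Defs.
From Stdlib Require Import Reals Lra.
From Coquelicot Require Import Coquelicot.
Open Scope R_scope.

(** * Inner and cross products in [R3] *)

Lemma R3_ext (a b : R3) :
  fst (fst a) = fst (fst b) -> snd (fst a) = snd (fst b) -> snd a = snd b -> a = b.
Proof.
destruct a as [[a1 a2] a3], b as [[b1 b2] b3]; simpl; congruence.
Qed.

Lemma dot_comm (a b : R3) : dot a b = dot b a.
Proof. unfold dot; ring. Qed.

Lemma dot_plus_l (a b c : R3) : dot (plus a b) c = dot a c + dot b c.
Proof.
destruct a as [[a1 a2] a3], b as [[b1 b2] b3], c as [[c1 c2] c3].
unfold dot; simpl; unfold plus; simpl; ring.
Qed.

Lemma dot_opp_l (a c : R3) : dot (opp a) c = - dot a c.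
Proof.
destruct a as [[a1 a2] a3], c as [[c1 c2] c3].
unfold dot; simpl; unfold opp; simpl; ring.
Qed.

Lemma dot_scal_l (k : R) (a c : R3) : dot (scal k a) c = k * dot a c.
Proof.
destruct a as [[a1 a2] a3], c as [[c1 c2] c3].
unfold dot; simpl; unfold scal; simpl; unfold mult; simpl; ring.
Qed.

Lemma dot_minus_l (a b c : R3) : dot (minus a b) c = dot a c - dot b c.
Proof. unfold minus; rewrite dot_plus_l, dot_opp_l; ring. Qed.

Lemma dot_plus_r (a b c : R3) : dot c (plus a b) = dot c a + dot c b.
Proof. rewrite dot_comm, dot_plus_l, (dot_comm a), (dot_comm b); ring. Qed.

Lemma dot_minus_r (a b c : R3) : dot c (minus a b) = dot c a - dot c b.
Proof. rewrite dot_comm, dot_minus_l, (dot_comm a), (dot_comm b); ring. Qed.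

Lemma dot_scal_r (k : R) (a c : R3) : dot c (scal k a) = k * dot c a.
Proof. rewrite dot_comm, dot_scal_l, (dot_comm a); ring. Qed.

Lemma dot_zero_r (a : R3) : dot a zero = 0.
Proof. unfold dot; simpl; unfold zero; simpl; ring. Qed.

Lemma dot_self_ge0 (a : R3) : 0 <= dot a a.
Proof. unfold dot; nra. Qed.

Lemma dot_self_gt0 (a : R3) : a <> zero -> 0 < dot a a.
Proof.
intros Ha; destruct (Rle_lt_or_eq_dec _ _ (dot_self_ge0 a)) as [H|H]; [exact H|].
destruct a as [[a1 a2] a3]; unfold dot in H; simpl in H.
exfalso; apply Ha, R3_ext; [change (a1 = 0)|change (a2 = 0)|change (a3 = 0)]; nra.
Qed.

Lemma sqr_norm (a : R3) : norm a ^ 2 = dot a a.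
Proof. rewrite norm_R3, pow2_sqrt; [reflexivity | apply dot_self_ge0]. Qed.

Lemma norm_eq_of_sqr (a : R3) (d : R) : 0 <= d -> dot a a = d ^ 2 -> norm a = d.
Proof. intros Hd E; rewrite norm_R3, E; apply sqrt_pow2, Hd. Qed.

Definition cross (a b : R3) : R3 :=
  ((snd (fst a) * snd b - snd a * snd (fst b),
    snd a * fst (fst b) - fst (fst a) * snd b),
   fst (fst a) * snd (fst b) - snd (fst a) * fst (fst b)).

Lemma dot_cross_l (a b : R3) : dot (cross a b) a = 0.
Proof. unfold dot, cross; simpl; ring. Qed.

Lemma dot_cross_r (a b : R3) : dot (cross a b) b = 0.
Proof. unfold dot, cross; simpl; ring. Qed.

Lemma dot_cross_cross (a b : R3) :
  dot (cross a b) (cross a b) = dot a a * dot b b - dot a b ^ 2.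
Proof. unfold dot, cross; simpl; ring. Qed.

Lemma sqr_dot_cross (a b c : R3) : dot a b = 0 -> dot b c = 0 ->
  dot a (cross b c) ^ 2 = dot b b * (dot a a * dot c c - dot a c ^ 2).
Proof.
intros Hab Hbc.
(* The squared triple product is the Gram determinant of [a], [b], [c], here expanded along its
   first row; the two orthogonality relations then kill all but two terms. *)
transitivity (dot a a * (dot b b * dot c c - dot b c ^ 2)
  - dot a b * (dot a b * dot c c - dot b c * dot a c)
  + dot a c * (dot a b * dot b c - dot b b * dot a c)).
- unfold dot, cross; simpl; ring.
- rewrite Hab, Hbc; ring.
Qed.

(** * Differentiation rules and two facts of real analysis *)

Lemma is_derive_fst {V W : NormedModule R_AbsRing}
  (f : R -> prod_NormedModule R_AbsRing V W) (t : R) l :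
  is_derive f t l -> is_derive (fun s => fst (f s)) t (fst l).
Proof.
intros Hf.
apply (filterdiff_ext_lin _ (fun s : R => fst (scal s l)));
  [|now intros; destruct l].
apply (filterdiff_comp f fst (fun s => scal s l) fst Hf).
apply filterdiff_linear, is_linear_fst.
Qed.

Lemma is_derive_snd {V W : NormedModule R_AbsRing}
  (f : R -> prod_NormedModule R_AbsRing V W) (t : R) l :
  is_derive f t l -> is_derive (fun s => snd (f s)) t (snd l).
Proof.
intros Hf.
apply (filterdiff_ext_lin _ (fun s : R => snd (scal s l)));
  [|now intros; destruct l].
apply (filterdiff_comp f snd (fun s => scal s l) snd Hf).
apply filterdiff_linear, is_linear_snd.
Qed.

Lemma is_derive_mult_R (f g : R -> R) (t df dg d : R) :
  is_derive f t df -> is_derive g t dg -> d = df * g t + f t * dg ->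
  is_derive (fun s => f s * g s) t d.
Proof.
intros Hf Hg ->; exact (is_derive_mult f g t df dg Hf Hg Rmult_comm).
Qed.

Lemma is_derive_dot (f g : R -> R3) (t : R) (df dg : R3) :
  is_derive f t df -> is_derive g t dg ->
  is_derive (fun s => dot (f s) (g s)) t (dot df (g t) + dot (f t) dg).
Proof.
intros Hf Hg.
assert (Hf3 := is_derive_snd _ _ _ Hf); assert (Hg3 := is_derive_snd _ _ _ Hg).
apply is_derive_fst in Hf; apply is_derive_fst in Hg.
assert (Hf2 := is_derive_snd _ _ _ Hf); assert (Hg2 := is_derive_snd _ _ _ Hg).
apply is_derive_fst in Hf; apply is_derive_fst in Hg.
evar_last.
- apply @is_derive_plus; [apply @is_derive_plus|].
  + eapply is_derive_mult_R; [apply Hf|apply Hg|reflexivity].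
  + eapply is_derive_mult_R; [apply Hf2|apply Hg2|reflexivity].
  + eapply is_derive_mult_R; [apply Hf3|apply Hg3|reflexivity].
- unfold dot, plus; simpl; ring.
Qed.

Lemma constant_of_is_derive_zero (f : R -> R) :
  (forall t, is_derive f t 0) -> forall s t, f s = f t.
Proof.
intros Hf s t; destruct (Rtotal_order s t) as [H|[->|H]]; [|reflexivity|].
- apply (eq_is_derive f s t); [intros; apply Hf | exact H].
- symmetry; apply (eq_is_derive f t s); [intros; apply Hf | exact H].
Qed.

(** Testing against the basis vectors suffices. This turns vector identities into scalar ones, where
    bilinearity of [dot] and [ring] apply. *)
Lemma R3_ext_dot (a b : R3) : (forall c, dot c a = dot c b) -> a = b.
Proof.
destruct a as [[a1 a2] a3], b as [[b1 b2] b3]; intros H.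
assert (H1 := H ((1, 0), 0)); assert (H2 := H ((0, 1), 0)).
assert (H3 := H ((0, 0), 1)); unfold dot in *; simpl in *.
apply R3_ext; [change (a1 = b1 :> R)|change (a2 = b2 :> R)|change (a3 = b3 :> R)]; lra.
Qed.

(** The mean value theorem makes [f] outgrow a line of slope [k] on both sides of 0, and the
    intermediate value theorem fills the gap. *)
Lemma surjective_of_derivative_bound (f df : R -> R) (k : R) :
  0 < k -> (forall t, is_derive f t (df t)) -> (forall t, k <= df t) ->
  forall y, exists t, f t = y.
Proof.
intros Hk Hf Hdf y.
assert (Hc : continuity f).
{ intros t; apply continuity_pt_filterlim.
  apply (ex_derive_continuous f); exists (df t); apply Hf. }
(* A rise of slope [k] over a time [T] covers exactly the gap between [f 0] and [y]. *)
set (T := Rabs (y - f 0) / k).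
assert (HT : 0 <= T) by (apply Rdiv_le_0_compat; [apply Rabs_pos|exact Hk]).
assert (HkT : k * T = Rabs (y - f 0)) by (unfold T; field; lra).
destruct (MVT_gen f 0 T df) as [c1 [_ E1]]; try (intros; auto; fail).
destruct (MVT_gen f (-T) 0 df) as [c2 [_ E2]]; try (intros; auto; fail).
assert (H1 := Hdf c1); assert (H2 := Hdf c2).
assert (A1 := Rle_abs (y - f 0)); assert (A2 := Rle_abs (- (y - f 0))).
rewrite Rabs_Ropp in A2.
assert (L1 : y <= f T) by nra.
assert (L2 : f (-T) <= y) by nra.
destruct (IVT_gen f (-T) T y Hc) as [t [_ Ht]].
- split; [apply Rle_trans with (2 := L2), Rmin_l
         |apply Rle_trans with (1 := L1), Rmax_r].
- now exists t.
Qed.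

Lemma polar_form (p q A : R) : 0 <= A -> p ^ 2 + q ^ 2 = A ^ 2 ->
  exists theta, p = A * cos theta /\ q = A * sin theta.
Proof.
intros HA E.
destruct (Rle_lt_or_eq_dec _ _ HA) as [HA'|<-]; [|exists 0; rewrite !Rmult_0_l; split; nra].
assert (B : -1 <= p / A <= 1).
{ split; [apply Rle_div_r|apply Rle_div_l]; nra. }
assert (Hs : A * sin (acos (p / A)) = Rabs q).
{ rewrite sin_acos by exact B.
  replace (1 - (p / A)²) with ((q / A) ^ 2).
  - rewrite <- Rsqr_pow2, sqrt_Rsqr_abs, Rabs_div by lra.
    rewrite (Rabs_pos_eq A) by lra; field; lra.
  - unfold Rsqr; replace 1 with (A ^ 2 / A ^ 2) by (field; lra).
    rewrite <- E at 1; field; lra. }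
assert (Hcs : A * cos (acos (p / A)) = p) by (rewrite cos_acos by exact B; field; lra).
(* [acos] only yields angles with nonnegative sine, so the sign of [q] decides between
   [acos (p / A)] and its opposite. *)
destruct (Rle_dec 0 q) as [Hq|Hq].
- exists (acos (p / A)); split; [lra|rewrite Hs, Rabs_pos_eq; lra].
- exists (- acos (p / A)).
  rewrite cos_neg, sin_neg, Ropp_mult_distr_r_reverse, Hs, Hcs, Rabs_left1 by lra.
  split; ring.
Qed.

(** * Distances and the Laplace vector *)

Lemma sqr_dist3 (p q : R3) : dist3 p q ^ 2 = dot (minus p q) (minus p q).
Proof. apply sqr_norm. Qed.

Lemma dist3_ge0 (p q : R3) : 0 <= dist3 p q.
Proof. apply norm_ge_0. Qed.

Lemma dist3_gt0 (p q : R3) : p <> q -> 0 < dist3 p q.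
Proof.
intros Hpq; unfold dist3; rewrite norm_R3; apply sqrt_lt_R0, dot_self_gt0.
intros E; apply Hpq, R3_ext_dot; intros c.
assert (H : dot c (minus p q) = dot c zero) by now rewrite E.
rewrite dot_minus_r, dot_zero_r in H.
lra.
Qed.

(** This is [u x (y x u) - m y / |y|] with the double cross product expanded as
    [(u . u) y - (y . u) u], so that only inner products have to be handled. *)
Definition laplace (m : R) (y u : R3) : R3 :=
  minus (scal (dot u u - m / norm y) y) (scal (dot y u) u).

Lemma dot_laplace_l (m : R) (y u a : R3) :
  dot (laplace m y u) a = (dot u u - m / norm y) * dot y a - dot y u * dot u a.
Proof. unfold laplace; rewrite dot_minus_l, !dot_scal_l; ring. Qed.

Lemma dot_laplace_cross (m : R) (y u : R3) : dot (cross y u) (laplace m y u) = 0.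
Proof.
rewrite dot_comm, dot_laplace_l, (dot_comm y (cross _ _)), (dot_comm u (cross _ _)),
  dot_cross_l, dot_cross_r.
ring.
Qed.

Lemma dot_laplace_position (m : R) (y u : R3) : norm y <> 0 ->
  dot (laplace m y u) y = dot (cross y u) (cross y u) - m * norm y.
Proof.
intros Hy.
rewrite dot_laplace_l, (dot_comm u y), dot_cross_cross, <- !sqr_norm.
field; exact Hy.
Qed.

(** The length of the Laplace vector is [m] times the eccentricity, so the sign of the energy
    decides the type of the conic. *)
Lemma dot_laplace_laplace (m : R) (y u : R3) : norm y <> 0 ->
  dot (laplace m y u) (laplace m y u)
  = m ^ 2 + (dot u u - 2 * m / norm y) * dot (cross y u) (cross y u).
Proof.
intros Hy.
rewrite dot_laplace_l, !(dot_comm _ (laplace m y u)), !dot_laplace_l.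
rewrite (dot_comm u y), dot_cross_cross, <- (sqr_norm y).
field; exact Hy.
Qed.

(** * Further differentiation rules *)

Lemma is_derive_inv_scal (k : R) (f : R -> R) (t df : R) :
  is_derive f t df -> f t <> 0 ->
  is_derive (fun s => k / f s) t (- k * df / f t ^ 2).
Proof.
intros Hf Hn; evar_last.
- apply (is_derive_scal (fun s => / f s)), is_derive_inv; [exact Hf|exact Hn].
- field; exact Hn.
Qed.

Lemma is_derive_dot_const (c : R3) (f : R -> R3) (t : R) (df : R3) :
  is_derive f t df -> is_derive (fun s => dot c (f s)) t (dot c df).
Proof.
intros Hf; evar_last.
- apply is_derive_dot; [apply @is_derive_const|exact Hf].
- unfold dot; simpl; unfold zero; simpl; ring.
Qed.

Lemma is_derive_minus_const (f : R -> R3) (S : R3) (t : R) (df : R3) :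
  is_derive f t df -> is_derive (fun s => minus (f s) S) t df.
Proof.
intros Hf; evar_last.
- apply @is_derive_minus; [exact Hf|apply @is_derive_const].
- apply R3_ext_dot; intros c; rewrite dot_minus_r.
  change (dot c df - dot c zero = dot c df); rewrite dot_zero_r; ring.
Qed.


(** * Conservation laws *)

Lemma motion_dist_gt0 S m x v : inverse_square_motion S m x v ->
  forall t, 0 < dist3 (x t) S.
Proof. intros H t; apply dist3_gt0, H. Qed.

Lemma is_derive_dist S m x v : inverse_square_motion S m x v -> forall t,
  is_derive (fun s => dist3 (x s) S) t (dot (minus (x t) S) (v t) / dist3 (x t) S).
Proof.
intros H t; assert (Hr := motion_dist_gt0 _ _ _ _ H t).
destruct (H t) as [_ [Hx _]]; apply (is_derive_minus_const _ S) in Hx.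
apply (is_derive_ext (fun s => sqrt (dot (minus (x s) S) (minus (x s) S)))).
- intros s; symmetry; apply norm_R3.
- evar_last.
  + apply is_derive_sqrt; [apply is_derive_dot; apply Hx|].
    rewrite <- sqr_dist3; apply pow_lt, Hr.
  + cbv beta; rewrite <- norm_R3; fold (dist3 (x t) S); rewrite (dot_comm (v t)).
    field; lra.
Qed.

(** The function differentiated is [r r'], called [w] later. Its derivative is [v . v + y . v'], and
    [y . v' = - m / r] because the force is radial. *)
Lemma is_derive_radial S m x v : inverse_square_motion S m x v -> forall t,
  is_derive (fun s => dot (minus (x s) S) (v s)) t (dot (v t) (v t) - m / dist3 (x t) S).
Proof.
intros H t; assert (Hr := motion_dist_gt0 _ _ _ _ H t).
destruct (H t) as [_ [Hx Hv]]; apply (is_derive_minus_const _ S) in Hx.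
evar_last; [apply is_derive_dot; [apply Hx|apply Hv]|].
rewrite dot_scal_r, <- sqr_dist3; field; lra.
Qed.

Lemma energy_constant S m x v : inverse_square_motion S m x v -> forall s t,
  dot (v s) (v s) - 2 * m / dist3 (x s) S = dot (v t) (v t) - 2 * m / dist3 (x t) S.
Proof.
intros H.
apply (constant_of_is_derive_zero
  (fun s => dot (v s) (v s) - 2 * m / dist3 (x s) S)); intros t.
assert (Hr := motion_dist_gt0 _ _ _ _ H t).
destruct (H t) as [_ [_ Hv]].
evar_last; [apply @is_derive_minus|].
- apply is_derive_dot; apply Hv.
- apply is_derive_inv_scal; [apply (is_derive_dist S m x v H)|lra].
- rewrite dot_scal_l, dot_scal_r, (dot_comm (v t)); unfold minus, plus, opp; simpl.
  field; lra.
Qed.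

Lemma angular_momentum_constant S m x v : inverse_square_motion S m x v -> forall s t,
  cross (minus (x s) S) (v s) = cross (minus (x t) S) (v t).
Proof.
intros H s t.
(* By the Binet-Cauchy identity each side is [(a x b) . (y x v)]. Its derivative vanishes because
   the acceleration is parallel to [y]. *)
assert (A : forall a b,
  dot a (minus (x s) S) * dot b (v s) - dot b (minus (x s) S) * dot a (v s)
  = dot a (minus (x t) S) * dot b (v t) - dot b (minus (x t) S) * dot a (v t)).
{ intros a b; revert s t.
  apply (constant_of_is_derive_zero (fun s =>
    dot a (minus (x s) S) * dot b (v s) - dot b (minus (x s) S) * dot a (v s))); intros t.
  destruct (H t) as [_ [Hx Hv]]; apply (is_derive_minus_const _ S) in Hx.
  evar_last; [apply @is_derive_minus|].
  - eapply is_derive_mult_R;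
      [apply is_derive_dot_const, Hx|apply is_derive_dot_const, Hv|reflexivity].
  - eapply is_derive_mult_R;
      [apply is_derive_dot_const, Hx|apply is_derive_dot_const, Hv|reflexivity].
  - cbv beta; rewrite !dot_scal_r; unfold minus at 1, plus, opp; simpl; ring. }
(* Cyclic pairs of basis vectors give the three components of the cross product. *)
assert (A1 := A ((0, 1), 0) ((0, 0), 1)).
assert (A2 := A ((0, 0), 1) ((1, 0), 0)).
assert (A3 := A ((1, 0), 0) ((0, 1), 0)).
clear A H; revert A1 A2 A3.
generalize (minus (x s) S) (v s) (minus (x t) S) (v t).
intros [[a1 a2] a3] [[b1 b2] b3] [[c1 c2] c3] [[d1 d2] d3]; unfold dot; simpl; intros.
apply R3_ext;
  [change (a2 * b3 - a3 * b2 = c2 * d3 - c3 * d2)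
  |change (a3 * b1 - a1 * b3 = c3 * d1 - c1 * d3)
  |change (a1 * b2 - a2 * b1 = c1 * d2 - c2 * d1)]; lra.
Qed.

Lemma laplace_constant S m x v : inverse_square_motion S m x v -> forall s t,
  laplace m (minus (x s) S) (v s) = laplace m (minus (x t) S) (v t).
Proof.
intros H s0 t0.
set (C := dot (v t0) (v t0) - 2 * m / dist3 (x t0) S).
assert (HC : forall s, dot (v s) (v s) = C + 2 * m / dist3 (x s) S).
{ intros s; unfold C; rewrite (energy_constant _ _ _ _ H t0 s); ring. }
(* Conservation of energy replaces [v . v] by [C + 2 m / r], so the coefficient of [y] becomes a
   function of [r] alone. *)
assert (E : forall c s, dot c (laplace m (minus (x s) S) (v s))
  = (C + m / dist3 (x s) S) * dot c (minus (x s) S)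
    - dot (minus (x s) S) (v s) * dot c (v s)).
{ intros c s; rewrite dot_comm, dot_laplace_l, HC, (dot_comm c), (dot_comm c).
  fold (dist3 (x s) S); field; apply Rgt_not_eq, (motion_dist_gt0 _ _ _ _ H). }
apply R3_ext_dot; intros c; rewrite !E; clear E; revert s0 t0 C HC.
(* [C] must become a plain constant, detached from [t0], before [t0] can be generalized. *)
intros s0 t0 C HC; clearbody C; revert s0 t0.
apply (constant_of_is_derive_zero (fun s =>
  (C + m / dist3 (x s) S) * dot c (minus (x s) S)
  - dot (minus (x s) S) (v s) * dot c (v s))); intros t.
assert (Hr := motion_dist_gt0 _ _ _ _ H t).
assert (Hw := is_derive_radial _ _ _ _ H t).
assert (Hr' := is_derive_dist _ _ _ _ H t).
destruct (H t) as [_ [Hx Hv]]; apply (is_derive_minus_const _ S) in Hx.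
evar_last; [apply @is_derive_minus|].
- eapply is_derive_mult_R; [|apply is_derive_dot_const, Hx|reflexivity].
  apply @is_derive_plus; [apply @is_derive_const|].
  apply is_derive_inv_scal; [exact Hr'|lra].
- eapply is_derive_mult_R; [exact Hw|apply is_derive_dot_const, Hv|reflexivity].
- cbv beta; rewrite !dot_scal_r, HC.
  unfold minus at 1, plus, opp, zero; simpl; field; lra.
Qed.

(** * Conics from the focal equation [m r = Q - e . y] *)

Lemma dist_to_set_attained (X Y : R3) (L : R3 -> Prop) :
  L Y -> (forall Z, L Z -> dist3 X Y <= dist3 X Z) ->
  dist_to_set X L = Finite (dist3 X Y).
Proof.
intros HY HL; apply is_glb_Rbar_unique; split.
- intros d [Z [HZ ->]]; apply HL, HZ.
- intros b Hb; apply Hb; now exists Y.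
Qed.

(** Since [|e| = m], the distance from [X] to the line [e . y = Q] of the orbit plane is
    [|Q - e . y| / m], which the focal equation makes equal to [r]. *)
Lemma parabola_of_focal_equation (S h e : R3) (m Q : R) :
  0 < m -> 0 < Q -> dot h h = Q -> dot h e = 0 -> dot e e = m ^ 2 ->
  exists E, is_parabola E /\ forall X, dot h (minus X S) = 0 ->
    m * dist3 X S = Q - dot e (minus X S) -> E X.
Proof.
intros Hm HQ Hh Hhe He.
(* The directrix is parametrized by its direction [d], orthogonal to [e] within the plane, and by
   the foot [A] of the perpendicular from [S], where [e . (A - S) = Q]. *)
set (d := cross h e).
set (A := plus S (scal (Q / m ^ 2) e)).
set (P := fun X => dot h (minus X S) = 0).
set (L := fun X => exists s : R, X = plus A (scal s d)).
assert (Hdd : dot d d = Q * m ^ 2) by (unfold d; rewrite dot_cross_cross, Hh, He, Hhe; ring).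
assert (Hdh : dot d h = 0) by apply dot_cross_l.
assert (Hde : dot d e = 0) by apply dot_cross_r.
assert (Hm2 : 0 < m ^ 2) by now apply pow_lt.
exists (fun X => P X /\ Finite (dist3 X S) = dist_to_set X L); split.
- exists P, L, S; repeat split; try tauto.
  + exists S, h; split; [|reflexivity].
    intros ->; rewrite dot_zero_r in Hh; lra.
  + exists A, d; split; [|reflexivity].
    intros E; rewrite E, dot_zero_r in Hdd; nra.
  + intros Y [s ->]; unfold P, A.
    rewrite dot_minus_r, !dot_plus_r, !dot_scal_r, Hhe, (dot_comm h d), Hdh; ring.
  + unfold P; rewrite dot_minus_r; ring.
  + intros [s E].
    assert (F : dot e S = dot e (plus A (scal s d))) by now rewrite <- E.
    unfold A in F.
    rewrite !dot_plus_r, !dot_scal_r, He, (dot_comm e d), Hde in F.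
    assert (Q / m ^ 2 * m ^ 2 = Q) by (field; lra); nra.
- intros X HP HX; split; [exact HP|].
  set (y := minus X S) in *.
  (* Parameter of the foot of the perpendicular from [X]: [Q m^2] is [d . d], and [A - S] is
     orthogonal to [d]. *)
  set (s0 := dot y d / (Q * m ^ 2)).
  assert (HQm : 0 < Q * m ^ 2) by nra.
  assert (G : dot y d ^ 2 = Q * (dot y y * m ^ 2 - dot y e ^ 2)).
  { unfold d; rewrite sqr_dot_cross, Hh, He; auto.
    rewrite dot_comm; exact HP. }
  (* Pythagoras, with the focal equation already used to identify the perpendicular distance with
     [r]. *)
  assert (K : forall s, dist3 X (plus A (scal s d)) ^ 2
     = dist3 X S ^ 2 + Q * m ^ 2 * (s - s0) ^ 2).
  { intros s; rewrite sqr_dist3.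
    replace (minus X (plus A (scal s d)))
      with (minus y (plus (scal (Q / m ^ 2) e) (scal s d))).
    2:{ apply R3_ext_dot; intros c; unfold y, A.
        rewrite !dot_minus_r, !dot_plus_r; ring. }
    rewrite !dot_minus_r, !dot_minus_l, !dot_plus_r, !dot_plus_l, !dot_scal_r, !dot_scal_l.
    rewrite He, Hdd, (dot_comm e d), Hde, (dot_comm e y), (dot_comm d y).
    assert (HX2 : m ^ 2 * dist3 X S ^ 2 = (Q - dot y e) ^ 2).
    { rewrite (dot_comm y e), <- HX; ring. }
    rewrite sqr_dist3 in HX2 |- *; fold y in HX2 |- *.
    replace (Q * m ^ 2 * (s - s0) ^ 2)
      with (Q * m ^ 2 * s ^ 2 - 2 * s * dot y d + dot y d ^ 2 / (Q * m ^ 2))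
      by (unfold s0; field; lra).
    rewrite G; apply (Rmult_eq_reg_l (m ^ 2)); [|lra].
    field_simplify; [|lra|lra].
    nra. }
  rewrite (dist_to_set_attained X (plus A (scal s0 d)) L).
  + f_equal; symmetry; apply norm_eq_of_sqr; [apply dist3_ge0|].
    rewrite <- sqr_dist3, K; ring.
  + now exists s0.
  + intros Z [s ->]; apply Rsqr_incr_0_var; [|apply dist3_ge0].
    assert (0 <= Q * m ^ 2 * (s - s0) ^ 2)
      by (apply Rmult_le_pos; [lra|apply pow2_ge_0]).
    rewrite !Rsqr_pow2.
    apply Rle_trans with (1 := Req_le _ _ (K s0)).
    apply Rle_trans with (2 := Req_le_sym _ _ (K s)).
    rewrite Rminus_eq_0; lra.
Qed.

(** Expanding the square and inserting [e . y = Q - m r] cancels the terms in [Q] and leaves a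
    perfect square. *)
Lemma sqr_dist_second_focus (S e X : R3) (m Q C : R) :
  C <> 0 -> dot e e = m ^ 2 + C * Q -> m * dist3 X S = Q - dot e (minus X S) ->
  dist3 X (plus S (scal (2 / C) e)) ^ 2 = (dist3 X S + 2 * m / C) ^ 2.
Proof.
intros HC He HX; rewrite sqr_dist3.
replace (minus X (plus S (scal (2 / C) e))) with (minus (minus X S) (scal (2 / C) e)).
2:{ apply R3_ext_dot; intros c; rewrite !dot_minus_r, dot_plus_r; ring. }
assert (Hr := sqr_dist3 X S); set (y := minus X S) in *.
rewrite !dot_minus_r, !dot_minus_l, !dot_scal_r, !dot_scal_l, He, (dot_comm y e), <- Hr.
replace (dot e y) with (Q - m * dist3 X S) by lra.
field; exact HC.
Qed.

Lemma sqr_dist_foci (S e : R3) (k : R) :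
  dist3 S (plus S (scal k e)) ^ 2 = k ^ 2 * dot e e.
Proof.
rewrite sqr_dist3, !dot_minus_r, !dot_minus_l, !dot_plus_r, !dot_plus_l,
  !dot_scal_r, !dot_scal_l; ring.
Qed.

Lemma is_plane_normal (S h : R3) (Q : R) : 0 < Q -> dot h h = Q ->
  is_plane (fun X => dot h (minus X S) = 0).
Proof.
intros HQ Hh; exists S, h; split; [|reflexivity].
intros ->; rewrite dot_zero_r in Hh; lra.
Qed.

Lemma ellipse_of_focal_equation (S h e : R3) (m Q C : R) :
  0 < m -> 0 < Q -> C < 0 ->
  dot h h = Q -> dot h e = 0 -> dot e e = m ^ 2 + C * Q ->
  exists E, is_ellipse E /\ forall X, dot h (minus X S) = 0 ->
    m * dist3 X S = Q - dot e (minus X S) -> dist3 X S <= - (2 * m / C) -> E X.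
Proof.
intros Hm HQ HC Hh Hhe He.
set (F := plus S (scal (2 / C) e)).
assert (Ha : 0 < - (2 * m / C)).
{ replace (- (2 * m / C)) with (2 * m / - C) by (field; lra).
  apply Rdiv_lt_0_compat; lra. }
exists (fun X => dot h (minus X S) = 0 /\ dist3 X S + dist3 X F = 2 * (- m / C)); split.
- exists (fun X => dot h (minus X S) = 0), S, F, (- m / C); repeat split; try tauto.
  + now apply is_plane_normal with Q.
  + rewrite dot_minus_r; ring.
  + unfold F; rewrite dot_minus_r, dot_plus_r, dot_scal_r, Hhe; ring.
  + replace (2 * (- m / C)) with (- (2 * m / C)) by (field; lra).
    apply Rsqr_incrst_0; [|apply dist3_ge0|lra].
    rewrite !Rsqr_pow2; unfold F; rewrite sqr_dist_foci, He.
    apply Rminus_lt.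
    (* The squared focal distance differs from the squared major axis by [4 Q / C], which is
       negative. *)
    replace ((2 / C) ^ 2 * (m ^ 2 + C * Q) - (- (2 * m / C)) ^ 2)
      with (- (4 * Q / - C)) by (field; lra).
    apply Ropp_lt_gt_0_contravar, Rdiv_lt_0_compat; lra.
- intros X HP HX Hle; split; [exact HP|].
  (* The bound on [r] selects the negative of [r + 2 m / C] as the square root, so the two distances
     add up to the constant [- 2 m / C]. *)
  assert (HF : dist3 X F = - (2 * m / C) - dist3 X S).
  { apply norm_eq_of_sqr; [lra|].
    rewrite <- sqr_dist3; unfold F; rewrite (sqr_dist_second_focus S e X m Q C); [|lra|auto..].
    ring. }
  rewrite HF; field; lra.
Qed.

Lemma hyperbola_of_focal_equation (S h e : R3) (m Q C : R) :
  0 < m -> 0 < Q -> 0 < C ->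
  dot h h = Q -> dot h e = 0 -> dot e e = m ^ 2 + C * Q ->
  exists E, is_hyperbola E /\ forall X, dot h (minus X S) = 0 ->
    m * dist3 X S = Q - dot e (minus X S) -> E X.
Proof.
intros Hm HQ HC Hh Hhe He.
set (F := plus S (scal (2 / C) e)).
assert (Ha : 0 < 2 * m / C) by (apply Rdiv_lt_0_compat; lra).
assert (Ha' : 2 * (m / C) = 2 * m / C) by (field; lra).
exists (fun X => dot h (minus X S) = 0 /\ Rabs (dist3 X S - dist3 X F) = 2 * (m / C)); split.
- exists (fun X => dot h (minus X S) = 0), S, F, (m / C); repeat split; try tauto.
  + now apply is_plane_normal with Q.
  + rewrite dot_minus_r; ring.
  + unfold F; rewrite dot_minus_r, dot_plus_r, dot_scal_r, Hhe; ring.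
  + lra.
  + rewrite Ha'; apply Rsqr_incrst_0; [|lra|apply dist3_ge0].
    rewrite !Rsqr_pow2; unfold F; rewrite sqr_dist_foci, He.
    apply Rminus_lt.
    replace ((2 * m / C) ^ 2 - (2 / C) ^ 2 * (m ^ 2 + C * Q))
      with (- (4 * Q / C)) by (field; lra).
    apply Ropp_lt_gt_0_contravar, Rdiv_lt_0_compat; lra.
- intros X HP HX; split; [exact HP|].
  assert (Hr := dist3_ge0 X S).
  (* For positive [C] the root is [r + 2 m / C] itself, so [X] lies on the branch nearer to [S]. *)
  assert (HF : dist3 X F = dist3 X S + 2 * m / C).
  { apply norm_eq_of_sqr; [lra|].
    rewrite <- sqr_dist3; unfold F; rewrite (sqr_dist_second_focus S e X m Q C); [|lra|auto..].
    ring. }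
  rewrite HF, Ha', Rabs_left; lra.
Qed.

(** * Attainment of the extremal distances *)

(* The antiderivative of 1 / r is the eccentric anomaly: with respect to it, z is a
   harmonic oscillation of frequency c. *)
Lemma oscillation_attained (r w z : R -> R) (c M A phi : R) :
  0 < c -> 0 <= A -> (forall t, 0 < r t <= M) -> (forall t, ex_derive r t) ->
  (forall t, is_derive w t (z t / r t)) ->
  (forall t, is_derive z t (- c ^ 2 * w t / r t)) ->
  z 0 ^ 2 + c ^ 2 * w 0 ^ 2 = A ^ 2 ->
  exists t, z t = A * cos phi.
Proof.
intros Hc HA Hr Hr' Hw Hz HA2.
assert (Hi : forall t, continuous (fun s => / r s) t).
{ intros t; apply @ex_derive_continuous; apply ex_derive_inv; [apply Hr'|].
  apply Rgt_not_eq, Hr. }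
set (tau := fun t => RInt (fun s => / r s) 0 t).
assert (Htau : forall t, is_derive tau t (/ r t)).
{ intros t; apply (is_derive_RInt (fun s => / r s) tau 0 t); [|apply Hi].
  apply filter_forall; intros s; apply @RInt_correct.
  apply @ex_RInt_continuous; intros; apply Hi. }
assert (Htau0 : tau 0 = 0) by (unfold tau; now rewrite RInt_point).
assert (Hcos : forall t, is_derive (fun s => cos (c * tau s)) t (- c * sin (c * tau t) / r t)).
{ intros t; evar_last.
  - apply (is_derive_comp cos (fun s => c * tau s));
      [apply is_derive_cos|apply is_derive_scal, Htau].
  - unfold scal; simpl; unfold mult; simpl; field; apply Rgt_not_eq, Hr. }
assert (Hsin : forall t, is_derive (fun s => sin (c * tau s)) t (c * cos (c * tau t) / r t)).
{ intros t; evar_last.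
  - apply (is_derive_comp sin (fun s => c * tau s));
      [apply is_derive_sin|apply is_derive_scal, Htau].
  - unfold scal; simpl; unfold mult; simpl; field; apply Rgt_not_eq, Hr. }
(* [Hp] and [Hq] say that rotating [(z, c w)] back by the angle [c tau] gives its initial value. *)
assert (Hp : forall t, z t * cos (c * tau t) + w t * (c * sin (c * tau t)) = z 0).
{ intros t; transitivity (z 0 * cos (c * tau 0) + w 0 * (c * sin (c * tau 0))).
  2:{ rewrite Htau0, Rmult_0_r, cos_0, sin_0; ring. }
  apply (constant_of_is_derive_zero
    (fun t => z t * cos (c * tau t) + w t * (c * sin (c * tau t)))); intros s.
  evar_last; [apply @is_derive_plus|].
  - eapply is_derive_mult_R; [apply Hz|apply Hcos|reflexivity].
  - eapply is_derive_mult_R; [apply Hw|apply is_derive_scal, Hsin|reflexivity].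
  - unfold plus; simpl; field; apply Rgt_not_eq, Hr. }
assert (Hq : forall t, w t * (c * cos (c * tau t)) - z t * sin (c * tau t) = c * w 0).
{ intros t; transitivity (w 0 * (c * cos (c * tau 0)) - z 0 * sin (c * tau 0)).
  2:{ rewrite Htau0, Rmult_0_r, cos_0, sin_0; ring. }
  apply (constant_of_is_derive_zero
    (fun t => w t * (c * cos (c * tau t)) - z t * sin (c * tau t))); intros s.
  evar_last; [apply @is_derive_minus|].
  - eapply is_derive_mult_R; [apply Hw|apply is_derive_scal, Hcos|reflexivity].
  - eapply is_derive_mult_R; [apply Hz|apply Hsin|reflexivity].
  - unfold minus, plus, opp; simpl; field; apply Rgt_not_eq, Hr. }
destruct (polar_form (z 0) (c * w 0) A HA) as [theta [Ep Eq]]; [rewrite <- HA2; ring|].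
assert (HM : 0 < M) by (destruct (Hr 0); lra).
(* With [theta] the initial phase, [z = A cos (c tau + theta)]. As [r] is at most [M], [tau] grows
   at rate at least [/ M] and reaches the value giving phase [phi]. *)
destruct (surjective_of_derivative_bound tau (fun t => / r t) (/ M)) with ((phi - theta) / c)
  as [t Ht]; [now apply Rinv_0_lt_compat|exact Htau| |].
{ intros t; apply Rinv_le_contravar; apply Hr. }
exists t.
assert (E : z t = z 0 * cos (c * tau t) - c * w 0 * sin (c * tau t)).
{ rewrite <- (Hp t), <- (Hq t) at 1.
  assert (U := sin2_cos2 (c * tau t)); unfold Rsqr in U.
  transitivity (z t * (sin (c * tau t) * sin (c * tau t) + cos (c * tau t) * cos (c * tau t))).
  - rewrite U; ring.
  - ring. }
rewrite E, Ep, Eq, Ht.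
replace phi with ((c * ((phi - theta) / c)) + theta) at 3 by (field; lra).
rewrite cos_plus; ring.
Qed.

Lemma orbit_equations S m x v : inverse_square_motion S m x v -> forall t0 t,
  let C := dot (v t0) (v t0) - 2 * m / dist3 (x t0) S in
  let h := cross (minus (x t0) S) (v t0) in
  let e := laplace m (minus (x t0) S) (v t0) in
  dot h (minus (x t) S) = 0 /\
  m * dist3 (x t) S = dot h h - dot e (minus (x t) S) /\
  dot (v t) (v t) = C + 2 * m / dist3 (x t) S /\
  dot (minus (x t) S) (v t) ^ 2 = C * dist3 (x t) S ^ 2 + 2 * m * dist3 (x t) S - dot h h.
Proof.
intros H t0 t C h e.
assert (Hr := motion_dist_gt0 _ _ _ _ H t).
assert (HC : dot (v t) (v t) = C + 2 * m / dist3 (x t) S).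
{ unfold C; rewrite (energy_constant _ _ _ _ H t0 t); ring. }
assert (Hh : h = cross (minus (x t) S) (v t)) by apply (angular_momentum_constant _ _ _ _ H).
assert (He : e = laplace m (minus (x t) S) (v t)) by apply (laplace_constant _ _ _ _ H).
repeat split.
- rewrite Hh; apply dot_cross_l.
- rewrite He, Hh, dot_laplace_position; [unfold dist3; ring|].
  apply Rgt_not_eq, Hr.
- exact HC.
- rewrite Hh, dot_cross_cross, HC, <- sqr_dist3; field; lra.
Qed.

(* With w = r r', the cubic w^3 / 3 + Q w of Barker's equation has derivative at least
   2 m^2, hence vanishes at some time. *)
Lemma turning_point_exists S m x v C Q : 0 < m -> 0 <= C -> 0 < Q ->
  inverse_square_motion S m x v ->
  (forall t, dot (v t) (v t) = C + 2 * m / dist3 (x t) S) ->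
  (forall t, dot (minus (x t) S) (v t) ^ 2
     = C * dist3 (x t) S ^ 2 + 2 * m * dist3 (x t) S - Q) ->
  exists t, dot (minus (x t) S) (v t) = 0.
Proof.
intros Hm HC HQ H Hv Hw.
set (w := fun t => dot (minus (x t) S) (v t)).
destruct (surjective_of_derivative_bound
  (fun t => / 3 * (w t * (w t * w t)) + Q * w t)
  (fun t => (w t ^ 2 + Q) * (C + m / dist3 (x t) S)) (2 * m ^ 2)) with 0 as [t Ht].
- nra.
- intros t.
  assert (Dw : is_derive w t (C + m / dist3 (x t) S)).
  { evar_last; [apply (is_derive_radial _ _ _ _ H)|].
    rewrite Hv; field; apply Rgt_not_eq, (motion_dist_gt0 _ _ _ _ H). }
  evar_last; [apply @is_derive_plus; apply is_derive_scal; [|exact Dw]|].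
  + eapply is_derive_mult_R; [exact Dw| |reflexivity].
    eapply is_derive_mult_R; [exact Dw|exact Dw|reflexivity].
  + unfold plus; simpl; field; apply Rgt_not_eq, (motion_dist_gt0 _ _ _ _ H).
- intros t; unfold w; rewrite Hw.
  assert (Hr := motion_dist_gt0 _ _ _ _ H t); set (r := dist3 (x t) S) in *.
  replace ((C * r ^ 2 + 2 * m * r - Q + Q) * (C + m / r))
    with (C * C * (r * r) + 3 * (C * (m * r)) + 2 * m ^ 2) by (field; lra).
  assert (0 <= C * C * (r * r)) by (apply Rmult_le_pos; nra).
  assert (0 <= C * (m * r)) by (apply Rmult_le_pos; nra).
  lra.
- exists t; fold (w t).
  (* The second factor is positive, so the zero of the cubic is a zero of [w]. *)
  assert (E : w t * (/ 3 * (w t * w t) + Q) = 0) by (rewrite <- Ht; ring).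
  apply Rmult_integral in E; destruct E as [E|E]; [exact E|nra].
Qed.

(** The oscillating quantity is [z = C r + m]: [w' = z / r] and [z' = C w / r], so the frequency is
    [sqrt (- C)] and [z^2 - C w^2 = m^2 + C Q]. Phase 0 is the pericentre, phase [PI] the
    apocentre. *)
Lemma elliptic_motion_attains S m x v C Q A phi : 0 < m -> C < 0 -> 0 <= A ->
  A ^ 2 = m ^ 2 + C * Q -> inverse_square_motion S m x v ->
  (forall t, dot (v t) (v t) = C + 2 * m / dist3 (x t) S) ->
  (forall t, dot (minus (x t) S) (v t) ^ 2
     = C * dist3 (x t) S ^ 2 + 2 * m * dist3 (x t) S - Q) ->
  (forall t, dist3 (x t) S <= - (2 * m / C)) ->
  exists t, C * dist3 (x t) S + m = A * cos phi.
Proof.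
intros Hm HC HA HA2 H Hv Hw Hle.
assert (Hr := motion_dist_gt0 _ _ _ _ H).
assert (Hc2 : sqrt (- C) ^ 2 = - C) by (apply pow2_sqrt; lra).
apply (oscillation_attained (fun t => dist3 (x t) S)
  (fun t => dot (minus (x t) S) (v t)) (fun t => C * dist3 (x t) S + m)
  (sqrt (- C)) (- (2 * m / C))).
- apply sqrt_lt_R0; lra.
- exact HA.
- auto.
- intros t; eexists; apply (is_derive_dist _ _ _ _ H).
- intros t; evar_last; [apply (is_derive_radial _ _ _ _ H)|].
  rewrite Hv; field; apply Rgt_not_eq, Hr.
- intros t; rewrite Hc2; evar_last.
  + apply @is_derive_plus; [apply is_derive_scal, (is_derive_dist _ _ _ _ H)|].
    apply @is_derive_const.
  + unfold plus, zero; simpl; field; apply Rgt_not_eq, Hr.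
- rewrite Hc2, HA2, Hw; ring.
Qed.

(** * Initial data and the final theorem *)

Lemma angular_momentum_of_angle (y u : R3) : 0 < norm y -> 0 < norm u ->
  angle y u <> 0 -> angle y u <> PI ->
  dot (cross y u) (cross y u) = norm y ^ 2 * norm u ^ 2 * sin (angle y u) ^ 2 /\
  0 < dot (cross y u) (cross y u).
Proof.
intros Hy Hu H0 HPI; unfold angle in *.
set (c := dot y u / (norm y * norm u)) in *.
assert (Hc : dot y u = c * (norm y * norm u)) by (unfold c; field; lra).
assert (HN : 0 < norm y ^ 2 * norm u ^ 2)
  by (apply Rmult_lt_0_compat; apply pow_lt; assumption).
assert (HQ : dot (cross y u) (cross y u) = norm y ^ 2 * norm u ^ 2 * (1 - c ^ 2)).
{ rewrite dot_cross_cross, Hc, <- !sqr_norm; ring. }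
(* Cauchy-Schwarz, read off from the squared length of the cross product; it puts [c] in the range
   where [acos] inverts [cos]. *)
assert (Hge : 0 <= 1 - c ^ 2).
{ assert (G := dot_self_ge0 (cross y u)); rewrite HQ in G; nra. }
assert (Hb : -1 <= c <= 1) by nra.
assert (Hsin : sin (acos c) ^ 2 = 1 - c ^ 2).
{ rewrite sin_acos by exact Hb; rewrite Rsqr_pow2; apply pow2_sqrt, Hge. }
rewrite Hsin; split; [exact HQ|].
rewrite HQ; apply Rmult_lt_0_compat; [exact HN|].
destruct (Req_dec c 1) as [E|E]; [exfalso; apply H0; rewrite E; apply acos_1|].
destruct (Req_dec c (-1)) as [E'|E']; [exfalso; apply HPI|].
{ rewrite E'; change (-1) with (- (1)); rewrite acos_opp, acos_1; ring. }
nra.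
Qed.

Theorem mainTheorem3
  (S : R3) (m : R) (hm : 0 < m)
  (x v : R -> R3) (hx : inverse_square_motion S m x v)
  (t0 r0 v0 alpha0 : R)
  (hr0 : 0 < r0) (hv0 : 0 < v0)
  (hxr : dist3 (x t0) S = r0)
  (hvv : norm (v t0) = v0)
  (hangle : angle (minus (x t0) S) (v t0) = alpha0)
  (halpha_0 : alpha0 <> 0) (halpha_PI : alpha0 <> PI) :
  let C := v0 ^ 2 - 2 * m / r0 in
  let Q := r0 ^ 2 * v0 ^ 2 * sin alpha0 ^ 2 in
  (C = 0 -> travels_along x is_parabola) /\
  (C < 0 -> travels_along x is_ellipse) /\
  (C > 0 -> travels_along x is_hyperbola) /\
  (C = 0 -> is_minimal_distance x S (Q / (2 * m))) /\
  (C <> 0 ->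
     0 <= m ^ 2 + C * Q /\
     is_minimal_distance x S ((- m + sqrt (m ^ 2 + C * Q)) / C)) /\
  (C < 0 -> is_maximal_distance x S ((- m - sqrt (m ^ 2 + C * Q)) / C)).
Proof.
intros C Q.
assert (hy : norm (minus (x t0) S) = r0) by exact hxr.
set (h := cross (minus (x t0) S) (v t0)).
set (e := laplace m (minus (x t0) S) (v t0)).
destruct (angular_momentum_of_angle (minus (x t0) S) (v t0)) as [Hh HQ];
  [lra|lra|now rewrite hangle|now rewrite hangle|].
rewrite hy, hvv, hangle in Hh; fold h in Hh, HQ; rewrite Hh in HQ; fold Q in Hh, HQ.
assert (HC : dot (v t0) (v t0) - 2 * m / dist3 (x t0) S = C).
{ unfold C; now rewrite <- sqr_norm, hvv, hxr. }
assert (Hhe : dot h e = 0) by apply dot_laplace_cross.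
assert (He : dot e e = m ^ 2 + C * Q).
{ unfold e; rewrite dot_laplace_laplace by lra; fold h.
  now rewrite Hh, <- HC. }
assert (Hr := motion_dist_gt0 _ _ _ _ hx).
assert (O := orbit_equations _ _ _ _ hx t0); cbv zeta in O.
fold h e in O; rewrite HC, Hh in O.
assert (Hplane : forall t, dot h (minus (x t) S) = 0) by apply O.
assert (Hfocal : forall t, m * dist3 (x t) S = Q - dot e (minus (x t) S)) by apply O.
assert (Hv : forall t, dot (v t) (v t) = C + 2 * m / dist3 (x t) S) by apply O.
assert (Hw : forall t, dot (minus (x t) S) (v t) ^ 2
  = C * dist3 (x t) S ^ 2 + 2 * m * dist3 (x t) S - Q) by apply O.
clear O; clearbody C Q; clear HC.
assert (HA2 := pow2_sqrt (m ^ 2 + C * Q)).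
assert (HA := sqrt_pos (m ^ 2 + C * Q)).
assert (Hdisc : 0 <= m ^ 2 + C * Q) by (rewrite <- He; apply dot_self_ge0).
specialize (HA2 Hdisc); set (A := sqrt (m ^ 2 + C * Q)) in *.
assert (Hle : C < 0 -> forall t, dist3 (x t) S <= - (2 * m / C)).
{ intros HC t; assert (G := dot_self_ge0 (v t)); rewrite Hv in G.
  specialize (Hr t); set (r := dist3 (x t) S) in *.
  replace (- (2 * m / C)) with (2 * m / - C) by (field; lra).
  apply Rle_div_r; [lra|].
  apply (Rmult_le_compat_l r) in G; [|lra].
  replace (r * (C + 2 * m / r)) with (C * r + 2 * m) in G by (field; lra); lra. }
(* The difference of the two sides is [Q (r r')^2]. Taking roots gives the linear bounds [Hlow] and
   [Hup]. *)
assert (Hcone : forall t, (Q - m * dist3 (x t) S) ^ 2 <= (A * dist3 (x t) S) ^ 2).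
{ intros t; rewrite Rpow_mult_distr, HA2.
  assert (G := pow2_ge_0 (dot (minus (x t) S) (v t))); rewrite Hw in G; nra. }
assert (Hlow : forall t, Q <= (m + A) * dist3 (x t) S).
{ intros t; specialize (Hcone t); specialize (Hr t).
  assert (0 <= A * dist3 (x t) S) by nra; nra. }
assert (Hup : forall t, (m - A) * dist3 (x t) S <= Q).
{ intros t; specialize (Hcone t); specialize (Hr t).
  assert (0 <= A * dist3 (x t) S) by nra; nra. }
repeat split.
- intros HC.
  destruct (parabola_of_focal_equation S h e m Q) as [E [HE HX]]; auto.
  { rewrite He, HC; ring. }
  exists E; auto.
- intros HC.
  destruct (ellipse_of_focal_equation S h e m Q C) as [E [HE HX]]; auto.
  exists E; auto.
- intros HC.
  destruct (hyperbola_of_focal_equation S h e m Q C) as [E [HE HX]]; auto.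
  exists E; auto.
- destruct (turning_point_exists S m x v C Q) as [t Ht]; auto; [lra|].
  exists t; specialize (Hw t); rewrite Ht, H in Hw.
  apply (Rmult_eq_reg_l (2 * m)); [|lra]; field_simplify; lra.
- intros t; specialize (Hw t); rewrite H in Hw.
  assert (G := pow2_ge_0 (dot (minus (x t) S) (v t))).
  apply Rle_div_l; lra.
- exact Hdisc.
- assert (K : exists t, C * dist3 (x t) S + m = A).
  { destruct (Rlt_dec C 0) as [HC|HC].
    - destruct (elliptic_motion_attains S m x v C Q A 0) as [t Ht]; auto.
      exists t; rewrite Ht, cos_0; ring.
    - destruct (turning_point_exists S m x v C Q) as [t Ht]; auto; [lra|].
      exists t; specialize (Hw t); specialize (Hr t); rewrite Ht in Hw.
      (* Where [r r' = 0], multiplying [C r^2 + 2 m r = Q] by [C] and completing the square gives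
         [(C r + m)^2 = A^2]; here [C r + m] is positive. *)
      apply Rsqr_inj; [nra|exact HA|].
      rewrite !Rsqr_pow2, HA2; nra. }
  destruct K as [t Ht]; exists t; rewrite <- Ht; field; assumption.
- intros t; specialize (Hlow t).
  (* Equal because [A^2 - m^2 = C Q]; the new denominator is positive whatever the sign of [C]. *)
  replace ((- m + A) / C) with (Q / (m + A)).
  + apply Rle_div_l; lra.
  + apply (Rmult_eq_reg_l (C * (m + A))); [|apply Rmult_integral_contrapositive; lra].
    field_simplify; lra.
- destruct (elliptic_motion_attains S m x v C Q A PI) as [t Ht]; auto.
  rewrite cos_PI in Ht; exists t.
  replace (- m - A) with (C * dist3 (x t) S) by lra; field; lra.
- intros t; specialize (Hup t).
  (* For negative [C], [A^2 = m^2 + C Q] is below [m^2], so dividing [Hup] by [m - A] keeps its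
     direction. *)
  assert (HmA : A < m) by nra.
  replace ((- m - A) / C) with (Q / (m - A)).
  + apply Rle_div_r; lra.
  + apply (Rmult_eq_reg_l (C * (m - A))); [|apply Rmult_integral_contrapositive; lra].
    field_simplify; lra.
Qed.
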